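(* Let $x\in[0,1]$ be irrational, identified with its binary expansion in $X^\omega$, $X=\{0,1\}$. Then $x$ can be written uniquely either as $x=1^n0w$ with $n\ge 1$, or as $x=0^m1w$ with $m\ge 1$, for some infinite word $w\in X^\omega$. The Schreier graph $\Gamma_x$ of the action of $F$ on the orbit of $x$ with respect to $\{x_0,x_1\}$, pointed at $x$, is isomorphic, as a pointed directed graph with edges labeled by $x_0,x_1$, to the graph $P(w)$ defined in the context, with base vertex $a_{n-1}(g_0)$ if $x=1^n0w$ (where $a_0(g_0):=g_0$), and base vertex $b_m(g_0)$ if $x=0^m1w$. Under this isomorphism, labeling each vertex of $P(w)$ by the corresponding point of the orbit of $x$ (written in $X^\omega$): (1) the base vertex is labeled by $x$, and $g_0$ is labeled by $10w$; (2) the vertices whose label begins with $10$ are exactly the grey vertices, and each grey vertex is the root of a graph hanging down from it (the subgraph induced on this grey vertex and all its grey descendants under the left-child and right-child maps, together with all black and white vertices attached to these grey vertices) which is canonically isomorphic to the graph hanging down from the vertex $10w$; (3) the infinite path $g_0,g_1,g_2,\dots$ of grey vertices going upwards from the vertex $10w$ turns left at the $k$-th level (i.e. $g_{k-1}$ is the right child of $g_k$) if the $k$-th letter of $w$ is $0$, and turns right (i.e. $g_{k-1}$ is the left child of $g_k$) if the $k$-th letter of $w$ is $1$, for all $k\geq 1$; (4) the labels agree with the standard action of $F$ on $X^\omega$: if there is an edge labeled $s\in\{x_0,x_1\}$ from a vertex labeled $y$ to a vertex labeled $z$, then $z$ is the image of $y$ under $s$.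
   Context: Thompson's group $F$ is the group of all strictly increasing piecewise linear homeomorphisms of $[0,1]$ that are differentiable except at finitely many dyadic rationals and whose slopes are integer powers of $2$; products are read left to right, $(fg)(x)=g(f(x))$, and $x^f:=f(x)$. It is generated by $x_0,x_1$, where $x_0(t)=t/2$ on $[0,\frac12]$, $t-\frac14$ on $[\frac12,\frac34]$, $2t-1$ on $[\frac34,1]$; and $x_1(t)=t$ on $[0,\frac12]$, $\frac t2+\frac14$ on $[\frac12,\frac34]$, $t-\frac18$ on $[\frac34,\frac78]$, $2t-1$ on $[\frac78,1]$. The standard action of $F$ on the Cantor set $X^\omega$ of infinite words over $X=\{0,1\}$ is induced by binary expansions and is given by $x_0: 0u\mapsto 00u,\ 10u\mapsto 01u,\ 11u\mapsto 1u$; $x_1: 0u\mapsto 0u,\ 10u\mapsto 100u,\ 110u\mapsto 101u,\ 111u\mapsto 11u$. Schreier graph $\Gamma_x$: the vertices are the points of the $F$-orbit of $x$, and for $s\in\{x_0,x_1\}$ there is a directed edge labeled $s$ from $y$ to $z$ iff $y^s=z$; the base vertex is $x$. The graph $P(w)$ for $w=w_1w_2w_3\ldots\in X^\omega$. The grey vertices are: $g_k$ for $k\ge0$; $d_0(p)$ for finite words $p\in X^*$, with the identification $d_0(\varnothing)=g_0$; and $d_k(p)$ for $k\ge1$ and $p\in X^*$ ($\varnothing$ is the empty word). Each grey vertex has a left child and a right child, which are grey vertices: the left child of $d_k(p)$ is $d_k(1p)$ and its right child is $d_k(0p)$ for all $k\ge 0$, $p\in X^*$; for $k\ge1$, if $w_k=0$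 then the right child of $g_k$ is $g_{k-1}$ and its left child is $d_k(\varnothing)$, while if $w_k=1$ then the left child of $g_k$ is $g_{k-1}$ and its right child is $d_k(\varnothing)$. In addition, each grey vertex $v$ has attached white vertices $a_i(v)$, $i\ge1$, and black vertices $b_i(v)$, $i\ge1$ (all these vertices are distinct). The edges, for every grey $v$ and every $i\ge1$, are: labeled $x_0$: $v\to b_1(v)$, $b_i(v)\to b_{i+1}(v)$, $a_1(v)\to v$, $a_{i+1}(v)\to a_i(v)$; labeled $x_1$: a loop at $b_i(v)$, $a_{i+1}(v)\to a_i(v)$, $a_1(v)\to$ (left child of $v$), $v\to$ (right child of $v$). *)

(* Defs.v *)
From HB Require Import structures.
From mathcomp Require Export all_boot all_order all_algebra.
From mathcomp Require Export all_classical all_reals all_analysis.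
Export numFieldNormedType.Exports.
Export Order.TTheory GRing.Theory Num.Theory.
Set Implicit Arguments.
Unset Strict Implicit.
Unset Printing Implicit Defensive.
Local Open Scope classical_set_scope.
Local Open Scope ring_scope.

Definition piecewise_linear (R : realType) (f : R -> R) : Prop :=
  exists s : seq R, itv_partition 0 1 s /\
    forall i, (i < size s)%N -> exists a c : R,
      forall t, nth 1 (0 :: s) i <= t <= nth 1 s i -> f t = a * t + c.

Definition dyadic (R : realType) (t : R) : Prop :=
  exists (m : int) (n : nat), t = m%:~R / 2 ^+ n.

(** Elements of F are represented by functions [R -> R] of which only the
    restriction to [0, 1] matters; continuity of the inverse is automatic, by
    compactness of [0, 1]. *)
Record thompsonF (R : realType) (f : R -> R) : Prop := ThompsonF {
  thompsonF_bij : set_bij `[0, 1] `[0, 1] f;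
  thompsonF_continuous : {within `[0, 1], continuous f};
  thompsonF_increasing : {in `[0, 1] &, {homo f : t t' / t < t'}};
  thompsonF_linear : piecewise_linear f;
  thompsonF_slope : exists D : seq R, {in D, forall t, dyadic t} /\
    forall t, t \in `]0, 1[ -> t \notin D ->
      exists k : int, is_derive t 1 f (2 ^ k)
}.

Inductive gen := X0 | X1.

Definition genR (R : realType) (s : gen) (t : R) : R :=
  match s with
  | X0 => if t <= 1 / 2 then t / 2
          else if t <= 3 / 4 then t - 1 / 4
          else 2 * t - 1
  | X1 => if t <= 1 / 2 then t
          else if t <= 3 / 4 then t / 2 + 1 / 4
          else if t <= 7 / 8 then t - 1 / 8
          else 2 * t - 1
  end.

Definition orbitF (R : realType) (x : R) : set R :=
  [set y | exists2 f, thompsonF f & f x = y].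

(** Infinite words over {0, 1}: [false] is the letter 0, [true] the letter 1. *)

Definition word := nat -> bool.

Definition prepend (p : seq bool) (w : word) : word :=
  fun i => if (i < size p)%N then nth false p i else w (i - size p)%N.

Definition wdrop (n : nat) (w : word) : word := fun i => w (n + i)%N.

Definition binary_expansion (R : realType) (t : R) (u : word) : Prop :=
  (\sum_(0 <= i < n) (u i)%:R / 2 ^+ i.+1 : R) @[n --> \oo] --> t.

Definition std_act (s : gen) (u : word) : word :=
  match s with
  | X0 => match u 0%N, u 1%N with
          | false, _ => prepend [:: false; false] (wdrop 1 u)
          | true, false => prepend [:: false; true] (wdrop 2 u)
          | true, true => prepend [:: true] (wdrop 2 u)
          end
  | X1 => match u 0%N, u 1%N, u 2%N with
          | false, _, _ => u
          | true, false, _ => prepend [:: true; false; false] (wdrop 2 u)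
          | true, true, false => prepend [:: true; false; true] (wdrop 3 u)
          | true, true, true => prepend [:: true; true] (wdrop 3 u)
          end
  end.

(** [block b n w] is 1^n 0 w if [b = true] and 0^n 1 w if [b = false]. *)
Definition block (b : bool) (n : nat) (w : word) : word :=
  prepend (rcons (nseq n b) (~~ b)) w.

Record lgraph := LGraph {
  vertex :> Type;
  edge : gen -> vertex -> vertex -> Prop
}.

Definition graph_iso (G H : lgraph) (f : G -> H) : Prop :=
  bijective f /\ forall s y z, edge s y z <-> edge s (f y) (f z).

Definition pointed_iso (G : lgraph) (g : G) (H : lgraph) (h : H)
    (f : G -> H) : Prop :=
  graph_iso f /\ f g = h.

Definition induced (G : lgraph) (A : set G) : lgraph :=
  @LGraph (set_type A) (fun s y z => edge s (val y) (val z)).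

Definition schreier (R : realType) (x : R) : lgraph :=
  @LGraph (set_type (orbitF x)) (fun s y z => genR s (val y) = val z).

Lemma thompsonF_id (R : realType) : thompsonF (@id R).
Proof.
split.
- split; [by [] | by move=> ? ? | by move=> y; exists y].
- by apply: continuous_subspaceT => t; exact: cvg_id.
- by [].
- exists [:: 1]; split; first by split=> //=; rewrite ltr01.
  by move=> i _; exists 1, 0 => t _; rewrite mul1r addr0.
- by exists [::]; split=> // t _ _; exists 0; rewrite expr0z; exact: is_derive_id.
Qed.

Lemma orbitF_refl (R : realType) (x : R) : x \in orbitF x.
Proof. by rewrite inE; exists id => //; exact: thompsonF_id. Qed.

Definition schreier_base (R : realType) (x : R) : schreier x :=
  exist _ x (orbitF_refl x).

(** [Dv k p] is d_k(p) and [Gv k] is g_{k+1}, so that each grey vertex has a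
    unique name and g_0 = d_0(empty word) holds by definition. *)
Inductive grey := Gv of nat | Dv of nat & seq bool.

Definition g_ (k : nat) : grey := if k is k'.+1 then Gv k' else Dv 0 [::].

(** The letter w_{k+1} is [w k], hence it governs the children of [Gv k]. *)
Definition left_child (w : word) (v : grey) : grey :=
  match v with
  | Dv k p => Dv k (true :: p)
  | Gv k => if w k then g_ k else Dv k.+1 [::]
  end.

Definition right_child (w : word) (v : grey) : grey :=
  match v with
  | Dv k p => Dv k (false :: p)
  | Gv k => if w k then Dv k.+1 [::] else g_ k
  end.

(** [White i v] is a_{i+1}(v) and [Black i v] is b_{i+1}(v). *)
Inductive Pvertex :=
  | Grey of grey
  | White of nat & grey
  | Black of nat & grey.

(** With the convention a_0(v) = b_0(v) = v. *)
Definition a_ (i : nat) (v : grey) : Pvertex :=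
  if i is i'.+1 then White i' v else Grey v.

Definition b_ (i : nat) (v : grey) : Pvertex :=
  if i is i'.+1 then Black i' v else Grey v.

Inductive Pedge (w : word) : gen -> Pvertex -> Pvertex -> Prop :=
  | E0_grey v : Pedge w X0 (Grey v) (b_ 1 v)
  | E0_black v i : (1 <= i)%N -> Pedge w X0 (b_ i v) (b_ i.+1 v)
  | E0_white1 v : Pedge w X0 (a_ 1 v) (Grey v)
  | E0_white v i : (1 <= i)%N -> Pedge w X0 (a_ i.+1 v) (a_ i v)
  | E1_black v i : (1 <= i)%N -> Pedge w X1 (b_ i v) (b_ i v)
  | E1_white v i : (1 <= i)%N -> Pedge w X1 (a_ i.+1 v) (a_ i v)
  | E1_white1 v : Pedge w X1 (a_ 1 v) (Grey (left_child w v))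
  | E1_grey v : Pedge w X1 (Grey v) (Grey (right_child w v)).

Definition P (w : word) : lgraph := LGraph (Pedge w).

Definition P_base (b : bool) (n : nat) : Pvertex :=
  if b then a_ n.-1 (g_ 0) else b_ n (g_ 0).

(** The grey descendant of [v] reached by following [q]: [true] goes to the
    left child, [false] to the right child. *)
Definition descend (w : word) (v : grey) (q : seq bool) : grey :=
  foldl (fun v' c => if c then left_child w v' else right_child w v') v q.

Definition hanging (w : word) (v : grey) : lgraph :=
  @induced (P w) [set y | exists q i,
    y = a_ i (descend w v q) \/ y = b_ i (descend w v q)].

(** The map matches the vertices that have the same position relative to the
    roots [v] and [v']; the case of empty [q] and [i = 0] says that it sends
    root to root. *)
Definition canonical_iso (w : word) (v v' : grey)
    (psi : hanging w v -> hanging w v') : Prop :=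
  graph_iso psi /\
  forall (y : hanging w v) (q : seq bool) (i : nat),
    (val y = a_ i (descend w v q) -> val (psi y) = a_ i (descend w v' q)) /\
    (val y = b_ i (descend w v q) -> val (psi y) = b_ i (descend w v' q)).

(* Main.v *)
Require Import Defs.
From mathcomp Require Import zify ring lra.
Set Implicit Arguments.
Unset Strict Implicit.
Unset Printing Implicit Defensive.
Local Open Scope classical_set_scope.
Local Open Scope ring_scope.

(** The isomorphism is given by a formula. A grey vertex v carries an infinite
    word t(v), its tail label: t(g_k) is w with its first k letters removed, and
    passing to the left (right) child puts the letter 1 (0) in front. The vertex
    a_i(v) is labelled 1^(i+1) 0 t(v) and b_i(v) is labelled 0^i 1 t(v).
    Comparing with the rules for x_0 and x_1 shows that following an edge of
    P(w) is the same as applying a generator to the label ([plabel_next]); since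
    P(w) is a deterministic automaton, what remains is that the labels enumerate
    the orbit, each point once.

    The labels are distinct ([plabel_inj]). This is where irrationality enters,
    in the form that w is not eventually periodic. The words t(v) and w agree
    from some places on; for an aperiodic w the offset between these places, and
    hence the place where the agreement begins, is determined by the word t(v),
    and it determines v.

    The labels lie in the orbit ([plabel_orbit]), because P(w) is connected and
    an orbit is closed under the generators and their inverses. To compose maps
    without differentiating them, F is replaced by the maps [dyadic_PL], which
    are affine with dyadic data between finitely many dyadic points; they are
    stable under composition and inversion, and all of them belong to F.

    The labels exhaust the orbit ([plabel_onto]). Each element of F has the form
    t |-> 2^k t + c with c dyadic on every piece ([thompsonF_germ]): going from
    left to right starting at f 0 = 0, nothing changes at a point where f is
    differentiable, and at a dyadic breakpoint the constant changes by a dyadic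
    number. Hence if y = f x, suitable multiples 2^i y and 2^j x differ by an
    integer, so that the expansions of x and y have a common tail. Conversely
    any word sharing a tail with w is some t(v): climb to g_j, then come down
    spelling the missing letters.

    Finally the graphs hanging from two grey vertices are identified by matching
    the vertices that are reached by the same descent; descents are recovered
    from their end points, again because the words t(v) are distinct. *)

(** * Infinite words *)

Lemma prepend_cat p q w : prepend (p ++ q) w = prepend p (prepend q w).
Proof.
apply/funext => i; rewrite /prepend size_cat nth_cat.
have [ip|pi] := ltnP i (size p); first by rewrite ltn_addr.
by rewrite ltn_subLR // subnDA.
Qed.

Lemma prepend_cons c p w : prepend (c :: p) w = prepend [:: c] (prepend p w).
Proof. exact: (prepend_cat [:: c]). Qed.

Lemma prepend_nil w : prepend [::] w = w.
Proof. by apply/funext => i; rewrite /prepend /= subn0. Qed.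

Lemma wdrop_at0 n w : wdrop n w 0%N = w n.
Proof. by rewrite /wdrop addn0. Qed.

Lemma wdrop_wdrop i j w : wdrop i (wdrop j w) = wdrop (j + i) w.
Proof. by apply/funext => k; rewrite /wdrop addnA. Qed.

Lemma wdrop_prepend p w : wdrop (size p) (prepend p w) = w.
Proof.
by apply/funext => i; rewrite /wdrop /prepend ltnNge leq_addr /= addKn.
Qed.

Lemma wdrop1_prepend c p w : wdrop 1 (prepend (c :: p) w) = prepend p w.
Proof. by rewrite prepend_cons (wdrop_prepend [:: c]). Qed.

Lemma prepend_wdrop1 u : prepend [:: u 0%N] (wdrop 1 u) = u.
Proof. by apply/funext => -[//|i]; rewrite /prepend /wdrop /= add1n subn1. Qed.

Lemma prepend_size_inj p q v w :
  size p = size q -> prepend p v = prepend q w -> p = q.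
Proof.
move=> spq E; apply: (@eq_from_nth _ false) => // i ip.
by have := congr1 (@^~ i) E; rewrite /prepend -spq ip.
Qed.

Lemma blockS b n w : block b n.+1 w = prepend [:: b] (block b n w).
Proof. by rewrite /block /= prepend_cons. Qed.

Lemma block0 b w : block b 0 w = prepend [:: ~~ b] w.
Proof. by []. Qed.

Lemma block_lt b n w i : (i < n)%N -> block b n w i = b.
Proof.
move=> lt_in; rewrite /block /prepend size_rcons size_nseq ltnS ltnW //.
by rewrite nth_rcons size_nseq lt_in nth_nseq lt_in.
Qed.

Lemma block_at b n w : block b n w n = ~~ b.
Proof.
rewrite /block /prepend size_rcons size_nseq ltnSn nth_rcons size_nseq.
by rewrite ltnn eqxx.
Qed.

Lemma wdrop_block b n w : wdrop n.+1 (block b n w) = w.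
Proof.
have -> : n.+1 = size (rcons (nseq n b) (~~ b)) by rewrite size_rcons size_nseq.
exact: wdrop_prepend.
Qed.

(** The block of a word is read off its first change of letter. *)
Lemma block_inj b b' n n' w w' : (0 < n)%N -> (0 < n')%N ->
  block b n w = block b' n' w' -> [/\ b = b', n = n' & w = w'].
Proof.
move=> n0 n'0 E; have bb' : b = b'.
  by have := congr1 (@^~ 0%N) E; rewrite !block_lt.
subst b'.
have nn' : n = n'.
  have [lt_nn'|lt_n'n|//] := ltngtP n n'.
    by have := congr1 (@^~ n) E; rewrite block_at block_lt //; case: b {E}.
  by have := congr1 (@^~ n') E; rewrite block_at block_lt //; case: b {E}.
split=> //; rewrite -[w](wdrop_block b n) E nn'; exact: wdrop_block.
Qed.

Definition constant_word (u : word) := forall i, u i = u 0%N.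

Lemma block_exists u : ~ constant_word u ->
  exists b n w, (0 < n)%N /\ u = block b n w.
Proof.
move=> /existsNP[m um]; pose P i := u i != u 0%N.
have exP : exists i, P i by exists m; exact/eqP.
have minE := ex_minnP exP; case: minE => n Pn nmin.
exists (u 0%N), n, (wdrop n.+1 u); split.
  by case: (n) Pn => //; rewrite /P eqxx.
apply/funext => i; have [lt_in|lt_ni|->] := ltngtP i n.
- rewrite block_lt //; apply/eqP/negPn/negP => /nmin.
  by rewrite leqNgt lt_in.
- rewrite -(subnKC lt_ni) -[LHS]/(wdrop n.+1 u (i - n.+1)%N).
  by rewrite -[in RHS](addn0 n.+1) -[RHS]/(wdrop _ _ _) addn0 wdrop_block.
- by rewrite block_at; move: Pn; rewrite /P; case: (u n) (u 0%N) => -[].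
Qed.

(** Two equal shifts would make the word eventually periodic; this is all that
    the combinatorics of P(w) uses of the irrationality of the base point. *)
Definition aperiodic (w : word) := injective (wdrop^~ w).

(** * The standard action on words that start with a block *)

Lemma act0_0 u :
  std_act X0 (prepend [:: false] u) = prepend [:: false; false] u.
Proof. by rewrite /= wdrop1_prepend prepend_nil. Qed.

Lemma act0_10 u :
  std_act X0 (prepend [:: true; false] u) = prepend [:: false; true] u.
Proof. by rewrite /= (wdrop_prepend [:: true; false]). Qed.

Lemma act0_11 u :
  std_act X0 (prepend [:: true; true] u) = prepend [:: true] u.
Proof. by rewrite /= (wdrop_prepend [:: true; true]). Qed.

Lemma act1_0 u : std_act X1 (prepend [:: false] u) = prepend [:: false] u.
Proof. by []. Qed.

Lemma act1_10 u :
  std_act X1 (prepend [:: true; false] u) = prepend [:: true; false; false] u.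
Proof. by rewrite /= (wdrop_prepend [:: true; false]). Qed.

Lemma act1_110 u :
  std_act X1 (prepend [:: true; true; false] u) =
  prepend [:: true; false; true] u.
Proof. by rewrite /= (wdrop_prepend [:: true; true; false]). Qed.

Lemma act1_111 u :
  std_act X1 (prepend [:: true; true; true] u) = prepend [:: true; true] u.
Proof. by rewrite /= (wdrop_prepend [:: true; true; true]). Qed.

(** Describing the action through prefixes rather than through single letters
    lets both the combinatorial labels and the real values be computed by the
    same case analysis. *)
Variant std_act_spec : gen -> word -> word -> Prop :=
  | Act0_0 u :
      std_act_spec X0 (prepend [:: false] u) (prepend [:: false; false] u)
  | Act0_10 u :
      std_act_spec X0 (prepend [:: true; false] u) (prepend [:: false; true] u)
  | Act0_11 u :
      std_act_spec X0 (prepend [:: true; true] u) (prepend [:: true] u)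
  | Act1_0 u : std_act_spec X1 (prepend [:: false] u) (prepend [:: false] u)
  | Act1_10 u : std_act_spec X1 (prepend [:: true; false] u)
                             (prepend [:: true; false; false] u)
  | Act1_110 u : std_act_spec X1 (prepend [:: true; true; false] u)
                              (prepend [:: true; false; true] u)
  | Act1_111 u : std_act_spec X1 (prepend [:: true; true; true] u)
                              (prepend [:: true; true] u).

Lemma std_actP s u : std_act_spec s u (std_act s u).
Proof.
have u1 := prepend_wdrop1 u.
have u2 : prepend [:: u 0%N; u 1%N] (wdrop 2 u) = u.
  rewrite prepend_cons -[RHS]u1; congr prepend.
  exact: (prepend_wdrop1 (wdrop 1 u)).
have u3 : prepend [:: u 0%N; u 1%N; u 2%N] (wdrop 3 u) = u.
  rewrite -[RHS]u2 (prepend_cat [:: _; _] [:: _]); congr prepend.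
  exact: (prepend_wdrop1 (wdrop 2 u)).
case: s.
  move: u1 u2; case: (u 0%N); last first.
    by move=> <- _; rewrite act0_0; exact: Act0_0.
  move=> _; case: (u 1%N) => <-.
    by rewrite act0_11; exact: Act0_11.
  by rewrite act0_10; exact: Act0_10.
move: u1 u2 u3; case: (u 0%N); last first.
  by move=> <- _ _; rewrite act1_0; exact: Act1_0.
move=> _; case: (u 1%N); last by move=> <- _; rewrite act1_10; exact: Act1_10.
move=> _; case: (u 2%N) => <-.
  by rewrite act1_111; exact: Act1_111.
by rewrite act1_110; exact: Act1_110.
Qed.

(** * The labels of P(w) *)

Lemma descend_rcons w v q c :
  descend w v (rcons q c) =
  if c then left_child w (descend w v q) else right_child w (descend w v q).
Proof. by rewrite /descend foldl_rcons. Qed.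

Definition tail_label (w : word) (v : grey) : word :=
  match v with
  | Gv k => wdrop k.+1 w
  | Dv k p =>
      prepend p (if k is k'.+1 then prepend [:: ~~ w k'] (wdrop k w) else w)
  end.

Lemma tail_label_g w k : tail_label w (g_ k) = wdrop k w.
Proof. by case: k => //=; rewrite prepend_nil. Qed.

(** The recursion that defines the labels. At g_k it holds because the child
    that continues the path to g_0 is chosen by the letter w_k itself, whereas
    d_k starts with the opposite letter. *)
Lemma tail_label_child w v (c : bool) :
  tail_label w (if c then left_child w v else right_child w v) =
  prepend [:: c] (tail_label w v).
Proof.
have wk k : prepend [:: w k] (wdrop k.+1 w) = wdrop k w.
  rewrite -[RHS](prepend_wdrop1 (wdrop k w)) wdrop_wdrop addn1.
  by rewrite {2}/wdrop addn0.
case: v => [k|k p] /=; last by case: c; rewrite /= prepend_cons.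
by have := wk k; case: c; case Ek: (w k) => E;
  rewrite ?tail_label_g -?E /tail_label ?prepend_nil ?Ek.
Qed.

Lemma tail_label_descend w v q :
  tail_label w (descend w v q) = prepend (rev q) (tail_label w v).
Proof.
elim/last_ind: q => [|q c IHq]; first by rewrite /= prepend_nil.
by rewrite descend_rcons tail_label_child IHq rev_rcons -prepend_cons.
Qed.

(** The pair of places, in the tail label of v and in w, from which on the two
    words agree; neither place can be lowered keeping their difference. *)
Definition meet_at (v : grey) : nat * nat :=
  match v with
  | Gv k => (0, k.+1)
  | Dv 0 p => (size p, 0)
  | Dv k.+1 p => ((size p).+1, k.+1)
  end%N.

Lemma tail_label_meet w v :
  wdrop (meet_at v).1 (tail_label w v) = wdrop (meet_at v).2 w.
Proof.
case: v => [k|[|k] p] //=; first by rewrite wdrop_prepend.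
by rewrite -prepend_cat -addn1 -(size_cat p [:: ~~ w k]) wdrop_prepend.
Qed.

(** The branch d_k leaves the path of the g_k by the letter that w does not
    have, so the agreement cannot be extended to the left. *)
Lemma tail_label_before_meet w v :
  (0 < (meet_at v).1)%N -> (0 < (meet_at v).2)%N ->
  tail_label w v (meet_at v).1.-1 != w (meet_at v).2.-1.
Proof.
case: v => [k|[|k] p] //= _ _.
by rewrite /prepend ltnn subnn /=; case: (w k).
Qed.

(** Aperiodicity fixes the offset of the agreement; as neither agreement extends
    to the left, two of them with the same offset begin at the same place. *)
Lemma meet_at_unique w v v' : aperiodic w -> tail_label w v = tail_label w v' ->
  meet_at v = meet_at v'.
Proof.
wlog le_m : v v' / ((meet_at v).1 <= (meet_at v').1)%N.
  move=> H aw E; case/orP: (leq_total (meet_at v).1 (meet_at v').1) => ?.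
    exact: H.
  by apply/esym/H.
move=> aw E; have := tail_label_meet w v; have := tail_label_meet w v'.
have := @tail_label_before_meet w v'; rewrite E.
case: (meet_at v) le_m => m n; case: (meet_at v') => m' n' /= le_m B E2 E1.
have nm : (n + m' = n' + m)%N.
  by apply: aw; rewrite -!wdrop_wdrop -E1 -E2 !wdrop_wdrop addnC.
(* Otherwise the first word agrees with w at the place just before the
   agreement of the second one begins. *)
have [lt_m|] := ltnP m m'; last by move=> ?; congr pair; lia.
case: m' le_m B lt_m nm E2 => //= m' _ B lt_m nm E2.
case: n' B nm E2 => [|n'] B nm E2; first by lia.
case/negP: (B isT isT); apply/eqP.
have := congr1 (@^~ (m' - m)%N) E1; rewrite /wdrop subnKC //.
by rewrite (_ : n + (m' - m) = n')%N //; lia.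
Qed.

Lemma tail_label_inj w : aperiodic w -> injective (tail_label w).
Proof.
move=> aw v v' E; have := meet_at_unique aw E; move: E.
case: v => [k|[|k] p]; case: v' => [k'|[|k'] p'] //=.
- by move=> _ [->].
- by move=> E [] /prepend_size_inj /(_ E) ->.
- by move=> E [] /prepend_size_inj /[swap] <- /(_ _ _ E) ->.
Qed.

(** From g_j, which carries the j-th shift of w, any finite prefix is spelled by
    going down, the letter nearest to the tail first. *)
Lemma tail_label_surj w u i j : wdrop i u = wdrop j w ->
  exists v, tail_label w v = u.
Proof.
elim: i u => [|i IHi] u E; first by exists (g_ j); rewrite tail_label_g -E.
have [|v lv] := IHi (wdrop 1 u); first by rewrite wdrop_wdrop.
exists (if u 0%N then left_child w v else right_child w v).
by rewrite tail_label_child lv prepend_wdrop1.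
Qed.

(** Descents of different lengths lead to different offsets relative to w. *)
Lemma descend_inj w v : aperiodic w -> injective (descend w v).
Proof.
move=> aw q q' E; apply: (can_inj revK).
have E2 := congr1 (tail_label w) E; move: E2; rewrite !tail_label_descend => E2.
have m := tail_label_meet w v.
suff: size (rev q) = size (rev q') by move=> /prepend_size_inj/(_ E2).
set n := (meet_at v).1 in m *; set k := (meet_at v).2 in m *.
have H r : wdrop (size r + n) (prepend r (tail_label w v)) = wdrop k w.
  by rewrite -wdrop_wdrop wdrop_prepend.
apply: (@addnI k); apply: aw; rewrite -!wdrop_wdrop.
rewrite -[in LHS](H (rev q')) -[in RHS](H (rev q)) -E2 !wdrop_wdrop.
by apply: (congr1 (wdrop^~ _)); lia.
Qed.

Definition plabel (w : word) (y : Pvertex) : word :=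
  match y with
  | Grey v => block true 1 (tail_label w v)
  | White i v => block true i.+2 (tail_label w v)
  | Black i v => block false i.+1 (tail_label w v)
  end.

Lemma plabel_base w b n : (0 < n)%N -> plabel w (P_base b n) = block b n w.
Proof. by case: n b => [//|[|n]] [] _ /=; rewrite prepend_nil. Qed.

Lemma plabel_inj w : aperiodic w -> injective (plabel w).
Proof.
move=> aw [v|i v|i v] [v'|i' v'|i' v'] /= /block_inj[] //;
  by [move=> _ _ /(tail_label_inj aw) ->
     |move=> _ [<-] /(tail_label_inj aw) ->].
Qed.

Lemma plabel_surj w b n v : (0 < n)%N ->
  exists y, plabel w y = block b n (tail_label w v).
Proof.
case: n => // n _; case: b; last by exists (Black n v).
by case: n => [|n]; [exists (Grey v)|exists (White n v)].
Qed.

Lemma plabel_grey w y :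
  (exists w', plabel w y = prepend [:: true; false] w') <->
  exists v, y = Grey v.
Proof.
split=> [[w']|[v ->]]; last by exists (tail_label w v).
rewrite -[prepend _ _]/(block true 1 w'); case: y => [v _|i v|i v].
- by exists v.
- by move=> /block_inj[].
- by move=> /block_inj[].
Qed.

(** * P(w) as a deterministic automaton *)

(** Every vertex has exactly one outgoing edge with each label, so P(w) is given
    by a transition function. *)
Definition Pnext (w : word) (s : gen) (y : Pvertex) : Pvertex :=
  match s, y with
  | X0, Grey v => Black 0 v
  | X0, Black i v => Black i.+1 v
  | X1, Grey v => Grey (right_child w v)
  | X1, White 0 v => Grey (left_child w v)
  | X1, Black i v => Black i v
  | X0, White 0 v => Grey v
  | _, White i.+1 v => White i v
  end.

Lemma PedgeP w s y z : Pedge w s y z <-> z = Pnext w s y.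
Proof.
split=> [[]//= v [|i]//|->].
case: s; case: y => [v|[|i] v|i v] /=.
- exact: E0_grey.
- exact: E0_white1.
- exact: (@E0_white w v i.+1).
- exact: (@E0_black w v i.+1).
- exact: E1_grey.
- exact: E1_white1.
- exact: (@E1_white w v i.+1).
- exact: (@E1_black w v i.+1).
Qed.

Lemma plabel_next w s y : plabel w (Pnext w s y) = std_act s (plabel w y).
Proof.
have b2 b n u : block b n.+2 u = prepend [:: b; b] (block b n u).
  by rewrite !blockS (prepend_cat [:: b] [:: b]).
have b3 b n u : block b n.+3 u = prepend [:: b; b; b] (block b n u).
  by rewrite blockS b2 (prepend_cat [:: b] [:: b; b]).
have b1 u : block true 1 u = prepend [:: true; false] u by [].
case: s; case: y => [v|[|i] v|i v]; rewrite [Pnext _ _ _]/= /plabel.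
- by rewrite b1 act0_10.
- by rewrite b2 act0_11 b1 block0 (prepend_cat [:: true] [:: false]).
- by rewrite [in RHS]b2 act0_11 -blockS.
- by rewrite b2 [in RHS]blockS act0_0.
- rewrite !b1 act1_10 (tail_label_child w v false).
  by rewrite -(prepend_cat [:: true; false] [:: false]).
- rewrite b2 block0 -(prepend_cat [:: true; true] [:: false]) act1_110.
  rewrite b1 (tail_label_child w v true).
  by rewrite -(prepend_cat [:: true; false] [:: true]).
- by rewrite b3 act1_111 b2.
- by rewrite blockS act1_0.
Qed.

(** Connectedness, as an induction principle. The chains a_i, b_i lead to their
    grey vertex, the left child is reached from v through a_1(v), and every
    d_k(p) hangs from the path of the g_k. *)
Lemma P_connected w (Q : Pvertex -> Prop) :
  (forall s y, Q y <-> Q (Pnext w s y)) ->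
  forall y z, Q y -> Q z.
Proof.
move=> QE; suff H y : Q y <-> Q (Grey (g_ 0)) by move=> y z /H Q0; apply/H.
have [Qa Qb] : (forall i v, Q (White i v) <-> Q (Grey v)) /\
    (forall i v, Q (Black i v) <-> Q (Grey v)).
  split; elim=> [|i IHi] v; first exact: (QE X0 (White 0 v)).
  - by rewrite -IHi; exact: (QE X0 (White i.+1 v)).
  - by apply: iff_sym; exact: (QE X0 (Grey v)).
  - by rewrite -IHi; apply: iff_sym; exact: (QE X0 (Black i v)).
have Qchild v (c : bool) :
    Q (Grey (if c then left_child w v else right_child w v)) <-> Q (Grey v).
  apply: iff_sym; case: c; last exact: (QE X1 (Grey v)).
  by rewrite -(Qa 0%N); exact: (QE X1 (White 0 v)).
suff Qgrey v : Q (Grey v) <-> Q (Grey (g_ 0)).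
  by case: y => [v|i v|i v]; rewrite ?Qa ?Qb Qgrey.
have Qup k : Q (Grey (Gv k)) <-> Q (Grey (g_ k)).
  apply: iff_sym; have := Qchild (Gv k) (w k).
  by rewrite /=; case: (w k).
have Qg k : Q (Grey (Gv k)) <-> Q (Grey (g_ 0)).
  by elim: k => [|k IHk]; [exact: Qup|rewrite Qup].
case: v => // k p; elim: p => [|c p IHp].
  case: k => // k; rewrite -(Qg k); have := Qchild (Gv k) (~~ w k).
  by rewrite /=; case: (w k).
by rewrite -IHp; have := Qchild (Dv k p) c; case: c.
Qed.

(** * Hanging subgraphs *)

Definition relabel (h : grey -> grey) (y : Pvertex) : Pvertex :=
  match y with
  | Grey v => Grey (h v)
  | White i v => White i (h v)
  | Black i v => Black i (h v)
  end.

Lemma relabel_a h i v : relabel h (a_ i v) = a_ i (h v).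
Proof. by case: i. Qed.

Lemma relabel_b h i v : relabel h (b_ i v) = b_ i (h v).
Proof. by case: i. Qed.

(** The map is well defined because a descent is determined by its end. *)
Lemma transport_exists w v v' : aperiodic w ->
  exists h : grey -> grey, forall q, h (descend w v q) = descend w v' q.
Proof.
move=> aw; have /choice[h hP] : forall g, exists g',
    forall q, g = descend w v q -> g' = descend w v' q.
  move=> g; have [[q ->]|nq] := pselect (exists q, g = descend w v q).
    by exists (descend w v' q) => q' /(descend_inj aw) ->.
  by exists g => q E; case: nq; exists q.
by exists h => q; exact: hP.
Qed.

Definition hanging_set (w : word) (v : grey) : set (P w) :=
  [set y | exists q i, y = a_ i (descend w v q) \/ y = b_ i (descend w v q)].
Arguments hanging_set : clear implicits.

Lemma relabel_hanging w v v' h y :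
  (forall q, h (descend w v q) = descend w v' q) ->
  y \in hanging_set w v -> relabel h y \in hanging_set w v'.
Proof.
move=> hP; rewrite !inE => -[q [i]] [] ->; exists q, i;
  rewrite ?relabel_a ?relabel_b hP; by [left|right].
Qed.

Lemma relabel_hangingK w v v' h h' y :
  (forall q, h (descend w v q) = descend w v' q) ->
  (forall q, h' (descend w v' q) = descend w v q) ->
  y \in hanging_set w v -> relabel h' (relabel h y) = y.
Proof.
move=> hP h'P; rewrite inE => -[q [i]].
by case=> ->; rewrite ?(relabel_a, relabel_b) hP ?(relabel_a, relabel_b) h'P.
Qed.

(** Edges starting in a hanging graph stay in it and depend only on the relative
    position, so the transport commutes with the transitions. *)
Lemma relabel_next w v v' h s y :
  (forall q, h (descend w v q) = descend w v' q) ->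
  y \in hanging_set w v ->
  relabel h (Pnext w s y) = Pnext w s (relabel h y).
Proof.
move=> hP; rewrite inE => -[q [i yE]].
have hchild (c : bool) : h (if c then left_child w (descend w v q)
                           else right_child w (descend w v q)) =
    if c then left_child w (h (descend w v q))
    else right_child w (h (descend w v q)).
  by rewrite -descend_rcons !hP descend_rcons.
have hl := hchild true; have hr := hchild false; rewrite /= in hl hr.
by case: yE => ->; case: i => [|[|i]]; case: s => //=; rewrite ?hl ?hr.
Qed.

Lemma hanging_iso w v v' : aperiodic w ->
  exists psi : hanging w v -> hanging w v', canonical_iso psi.
Proof.
move=> aw.
have [h hP] := transport_exists v v' aw.
have [h' h'P] := transport_exists v' v aw.
pose psi (y : hanging w v) : hanging w v' :=
  exist (fun z => z \in hanging_set w v') _ (relabel_hanging hP (valP y)).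
pose psi' (y : hanging w v') : hanging w v :=
  exist (fun z => z \in hanging_set w v) _ (relabel_hanging h'P (valP y)).
have psiK : cancel psi psi'.
  by move=> [y yP]; apply: val_inj; exact: (relabel_hangingK hP h'P).
have psi'K : cancel psi' psi.
  by move=> [y yP]; apply: val_inj; exact: (relabel_hangingK h'P hP).
exists psi; split; last first.
  by move=> y q i; split=> /= ->; rewrite ?relabel_a ?relabel_b hP.
split; first by exists psi'.
move=> s [y yP] [z zP].
apply: (iff_trans (PedgeP w s y z)).
apply: (iff_trans _ (iff_sym (PedgeP w s (relabel h y) (relabel h z)))).
split=> [->|E]; first exact: (relabel_next _ hP).
rewrite -(relabel_hangingK hP h'P zP) E (relabel_next _ h'P); last first.
  exact: (relabel_hanging hP).
by rewrite (relabel_hangingK hP h'P).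
Qed.

(** * The value of a binary expansion *)

Definition bpartial (R : realType) (u : word) (n : nat) : R :=
  \sum_(0 <= i < n) (u i)%:R / 2 ^+ i.+1.

Definition bval (R : realType) (u : word) : R := limn (bpartial R u).

Lemma bpartialS (R : realType) u n :
  bpartial R u n.+1 = ((u 0%N)%:R + bpartial R (wdrop 1 u) n) / 2.
Proof.
rewrite /bpartial big_nat_recl // expr1 mulrDl mulr_suml; congr (_ + _).
by apply: eq_bigr => i _; rewrite [in LHS]exprS invfM mulrA mulrAC.
Qed.

Lemma bit01 (R : realType) (b : bool) : 0 <= (b%:R : R) <= 1.
Proof. by case: b; rewrite ?lexx ?ler01. Qed.

Lemma bpartial01 (R : realType) u n : 0 <= bpartial R u n <= 1.
Proof.
elim: n u => [|n IHn] u; first by rewrite /bpartial big_nil lexx ler01.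
rewrite bpartialS; have := IHn (wdrop 1 u); have := bit01 R (u 0%N); lra.
Qed.

Lemma cvg_bpartial (R : realType) u : bpartial R u @ \oo --> bval R u.
Proof.
apply: nondecreasing_is_cvgn.
  apply/nondecreasing_seqP => n; rewrite /bpartial big_nat_recr //= lerDl.
  by rewrite divr_ge0 ?exprn_ge0.
by exists 1 => _ [n _ <-]; case/andP: (bpartial01 R u n).
Qed.

Lemma binary_expansionP (R : realType) (t : R) u :
  binary_expansion t u <-> bval R u = t.
Proof.
split=> [|<-]; last exact: cvg_bpartial.
by move=> /cvg_lim; apply; exact: Rhausdorff.
Qed.

Lemma bval01 (R : realType) u : 0 <= bval R u <= 1.
Proof.
apply/andP; split.
  apply: limr_ge; first by apply: cvgP; exact: cvg_bpartial.
  by near=> n; case/andP: (bpartial01 R u n).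
apply: limr_le; first by apply: cvgP; exact: cvg_bpartial.
by near=> n; case/andP: (bpartial01 R u n).
Unshelve. all: by end_near. Qed.

Lemma bvalS (R : realType) u :
  bval R u = ((u 0%N)%:R + bval R (wdrop 1 u)) / 2.
Proof.
apply/binary_expansionP; rewrite /binary_expansion -/(bpartial R u).
rewrite -(cvg_shiftS (bpartial R u)) /=.
under eq_fun do rewrite bpartialS.
by apply: cvgMl; apply: cvgD; [exact: cvg_cst|exact: cvg_bpartial].
Qed.

Lemma bval_cons (R : realType) c u :
  bval R (prepend [:: c] u) = (c%:R + bval R u) / 2.
Proof. by rewrite bvalS (wdrop_prepend [:: c]). Qed.

(** Shifting a word n times multiplies its value by 2^n modulo the integers. *)
Lemma bval_wdrop (R : realType) u n : exists m : int,
  bval R (wdrop n u) = 2 ^+ n * bval R u - m%:~R.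
Proof.
elim: n => [|n [m IHn]]; first by exists 0; rewrite expr0 mul1r subr0.
exists (2 * m + (u n : nat)).
have := bvalS R (wdrop n u); rewrite wdrop_wdrop addn1 wdrop_at0 IHn.
by rewrite exprS rmorphD rmorphM /= => E; lra.
Qed.

(** * Rational numbers and irrational expansions *)

Lemma rational_int (R : realType) (m : int) : rational (m%:~R : R).
Proof. by exists m%:~R => //; rewrite ratr_int. Qed.

Lemma rationalD (R : realType) (a b : R) :
  rational a -> rational b -> rational (a + b).
Proof. by move=> [p _ <-] [q _ <-]; exists (p + q); rewrite ?rmorphD. Qed.

Lemma rationalM (R : realType) (a b : R) :
  rational a -> rational b -> rational (a * b).
Proof. by move=> [p _ <-] [q _ <-]; exists (p * q); rewrite ?rmorphM. Qed.

Lemma rationalV (R : realType) (a : R) : rational a -> rational a^-1.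
Proof. by move=> [p _ <-]; exists p^-1; rewrite ?fmorphV. Qed.

(** Used contrapositively: a rational affine map that is not constant preserves
    irrationality. *)
Lemma rational_affine (R : realType) (a b t : R) : a != 0 ->
  rational a -> rational b -> rational (a * t + b) -> rational t.
Proof.
move=> a0 ra rb rt; rewrite -(mulKf a0 t); apply: rationalM.
  exact: rationalV.
rewrite -(addrK b (a * t)); apply: rationalD => //.
by rewrite -mulN1r; apply: rationalM => //; exact: (rational_int R (-1)).
Qed.

Lemma rational_pow2 (R : realType) n : rational (2 ^+ n : R).
Proof.
by rewrite -[2]/(2%:~R) -rmorphXn /=; exact: rational_int.
Qed.

Lemma irrational_wdrop (R : realType) u n :
  irrational (bval R (wdrop n u)) <-> irrational (bval R u).
Proof.
have [m E] := bval_wdrop R u n.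
have n0 : (2 ^+ n : R) != 0 by rewrite expf_neq0.
split=> ir r; apply: ir.
  rewrite E; apply: rationalD.
    by apply: rationalM => //; exact: rational_pow2.
  by rewrite -rmorphN; exact: rational_int.
move: r; rewrite E; apply: rational_affine => //; first exact: rational_pow2.
by rewrite -rmorphN; exact: rational_int.
Qed.

Lemma irrational_block (R : realType) b n w :
  irrational (bval R (block b n w)) <-> irrational (bval R w).
Proof. by rewrite -(irrational_wdrop _ (block b n w) n.+1) wdrop_block. Qed.

Lemma irrational01 (R : realType) u : irrational (bval R u) -> 0 < bval R u < 1.
Proof.
move=> ir; have /andP[u0 u1] := bval01 R u; rewrite !lt_neqAle u0 u1 !andbT.
apply/andP; split; apply/eqP => E; apply: ir.
  by rewrite -E; exact: (rational_int R 0).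
by rewrite E; exact: (rational_int R 1).
Qed.

(** The values of all shifts are irrational, hence differ from 0 and 1; so the
    first letter is 0 or 1 according to the side of 1/2 on which the value lies,
    and one proceeds with the shift. *)
Lemma bval_inj (R : realType) u v :
  irrational (bval R u) -> bval R u = bval R v -> u = v.
Proof.
move=> iru E; apply/funext => n.
elim: n u v iru E => [|n IHn] u v iru E.
all: have /andP[u0 u1] := irrational01 ((irrational_wdrop R u 1).2 iru).
all: have irv : irrational (bval R v) by rewrite -E.
all: have /andP[v0 v1] := irrational01 ((irrational_wdrop R v 1).2 irv).
all: have uv : u 0%N = v 0%N.
1,3: move: E; rewrite (bvalS R u) (bvalS R v);
  by case: (u 0%N) (v 0%N) => -[] //=; lra.
  exact: uv.
apply: (IHn (wdrop 1 u) (wdrop 1 v)); first by apply/irrational_wdrop.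
by move: E; rewrite (bvalS R u) (bvalS R v) uv; lra.
Qed.

(** If two shifts coincide, their common value t satisfies (2^d - 1) t = m with
    d > 0 and m an integer. *)
Lemma irrational_aperiodic (R : realType) w :
  irrational (bval R w) -> aperiodic w.
Proof.
move=> ir i j; wlog lt_ij : i j / (i < j)%N.
  by move=> H E; case: (ltngtP i j) => // lt; [exact: H|apply/esym/H].
move=> E; exfalso.
have [m] := bval_wdrop R (wdrop i w) (j - i).
rewrite wdrop_wdrop (subnKC (ltnW lt_ij)) -E.
move=> E2; apply: ((irrational_wdrop R w i).2 ir).
apply: (@rational_affine _ (2 ^+ (j - i) - 1) (- m%:~R)).
- by rewrite subr_eq0 gt_eqF // exprn_egt1 // ?ltr1n // -lt0n subn_gt0.
- by apply: rationalD; [exact: rational_pow2|exact: (rational_int R (-1))].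
- by rewrite -rmorphN; exact: rational_int.
rewrite (_ : _ + _ = 0); first exact: (rational_int R 0).
by rewrite mulrBl mul1r addrAC -E2 subrr.
Qed.

Lemma irrational_constant (R : realType) u :
  irrational (bval R u) -> ~ constant_word u.
Proof.
move=> /irrational_aperiodic au cu; suff : (0 = 1)%N by [].
by apply: au; apply/funext => i; rewrite /wdrop !cu.
Qed.

Lemma eq_of_dist_pow2 (R : realType) (a b : R) :
  (forall n, 2 ^+ n * `|a - b| <= 1) -> a = b.
Proof.
move=> H; apply/eqP; rewrite -subr_eq0 -normr_eq0; apply/negPn/negP => d0.
have dgt0 : 0 < `|a - b| by rewrite lt_def d0 normr_ge0.
pose n := Num.bound (`|a - b|^-1).
have nP : `|a - b|^-1 < n%:R by apply: archi_boundP; rewrite invr_ge0.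
have := H n; apply/negP; rewrite -ltNge -ltr_pdivrMr // div1r.
by apply: lt_trans nP _; rewrite -natrX ltr_nat ltn_expl.
Qed.

(** The digits are read from the orbit of t under the doubling map; this map and
    the shift subtract the same integers, which bounds 2^n times the error. *)
Lemma bval_surj (R : realType) (t : R) : 0 <= t <= 1 -> exists u, bval R u = t.
Proof.
move=> t01.
pose r n := iter n (fun s : R => 2 * s - (1 / 2 <= s)%R%:R) t.
pose u : word := fun n => (1 / 2 <= r n)%R.
have r01 n : 0 <= r n <= 1.
  elim: n => [//|n]; rewrite /r iterS -/(r n).
  by case: (leP (1/2) (r n)) => /= h1 h2; lra.
exists u; apply: eq_of_dist_pow2 => n.
have : exists m : int, r n = 2 ^+ n * t - m%:~R /\
                     bval R (wdrop n u) = 2 ^+ n * bval R u - m%:~R.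
  elim: n => [|n [m [IH1 IH2]]]; first by exists 0; rewrite expr0 !mul1r !subr0.
  exists (2 * m + (u n : nat)).
  have := bvalS R (wdrop n u); rewrite wdrop_wdrop addn1 wdrop_at0 IH2.
  rewrite /r iterS -/(r n) -/(u n) IH1 exprS rmorphD rmorphM /= => E.
  by split; [rewrite mulrBr mulrA opprD addrA|lra].
move=> [m [E1 E2]]; have := r01 n; have := bval01 R (wdrop n u).
rewrite E1 E2 => h1 h2.
rewrite -(ger0_norm (exprn_ge0 n (ler0n R 2))) -normrM mulrBr ler_norml; lra.
Qed.

(** * The action of the generators on the interval *)

(** The formulas of the generators agree at the breakpoints, so the ambiguity of
    dyadic expansions does no harm. *)
Lemma bval_std_act (R : realType) s u :
  bval R (std_act s u) = genR s (bval R u).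
Proof.
case: (std_actP s u) => {}u;
  rewrite ?(prepend_cons _ (_ :: _)) ?bval_cons /genR /=; have := bval01 R u;
  by repeat case: ifP => [/idP|/negbT]; rewrite -?ltNge => *; lra.
Qed.

(** * Dyadic affine maps preserve tails *)

(** Clearing denominators is the form in which dyadic numbers are combined with
    shifts of expansions. *)
Lemma dyadicE (R : realType) (c : R) :
  dyadic c <-> exists (n : nat) (m : int), 2 ^+ n * c = m%:~R.
Proof.
have p0 n : (2 ^+ n : R) != 0 by rewrite expf_neq0.
split=> [[m [n ->]]|[n [m E]]]; first by exists n, m; rewrite mulrC divfK.
by exists m, n; rewrite -E mulrAC divff ?mul1r.
Qed.

Lemma dyadic_int (R : realType) (m : int) : dyadic (m%:~R : R).
Proof. by exists m, 0%N; rewrite expr0 divr1. Qed.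

Lemma dyadicD (R : realType) (a b : R) : dyadic a -> dyadic b -> dyadic (a + b).
Proof.
move=> /dyadicE[n [m E]] /dyadicE[n' [m' E']]; apply/dyadicE.
exists (n + n')%N, (2 ^+ n' * m + 2 ^+ n * m').
by rewrite rmorphD !rmorphM !rmorphXn /= -E -E' exprD; ring.
Qed.

Lemma dyadicM (R : realType) (a b : R) : dyadic a -> dyadic b -> dyadic (a * b).
Proof.
move=> /dyadicE[n [m E]] /dyadicE[n' [m' E']]; apply/dyadicE.
exists (n + n')%N, (m * m'); rewrite rmorphM /= -E -E' exprD; ring.
Qed.

Lemma dyadicN (R : realType) (a : R) : dyadic a -> dyadic (- a).
Proof.
by move=> da; rewrite -mulN1r; apply: dyadicM => //; exact: (dyadic_int R (-1)).
Qed.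

Lemma dyadic_exp2z (R : realType) (k : int) : dyadic (2 ^ k : R).
Proof.
case: k => k.
  by rewrite -exprnP -[2]/(2%:~R) -rmorphXn; exact: dyadic_int.
by exists 1, k.+1; rewrite NegzE mul1r exprnN.
Qed.

(** After multiplication by powers of 2 the relation says that a shift of v and
    a shift of u have values differing by an integer; both values lie strictly
    between 0 and 1, so they are equal. *)
Lemma dyadic_affine_tail (R : realType) u v (k : int) (c : R) :
  irrational (bval R u) -> irrational (bval R v) -> dyadic c ->
  bval R v = 2 ^ k * bval R u + c ->
  exists i j, wdrop i v = wdrop j u.
Proof.
move=> iru irv /dyadicE[N [m mE]] E.
have [i [j [M EM]]] : exists i j, exists M : int,
    2 ^+ i * bval R v = 2 ^+ j * bval R u + M%:~R.
  case: k E => k E.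
    exists N, (N + k)%N, m; rewrite E -mE -exprnP exprD; ring.
  exists (N + k.+1)%N, N, (2 ^+ k.+1 * m).
  rewrite E rmorphM rmorphXn /= -mE NegzE -exprnN exprD !mulrDr mulrA.
  by rewrite mulfK ?expf_neq0 //; ring.
exists i, j.
have [mv Ev] := bval_wdrop R v i; have [mu Eu] := bval_wdrop R u j.
have irv' : irrational (bval R (wdrop i v)) by apply/irrational_wdrop.
have iru' : irrational (bval R (wdrop j u)) by apply/irrational_wdrop.
apply: (bval_inj irv').
have := irrational01 irv'; have := irrational01 iru'.
have Ed : bval R (wdrop i v) - bval R (wdrop j u) = (M - mv + mu)%:~R.
  by rewrite Ev Eu EM !rmorphD rmorphN /=; ring.
move=> u01 v01.
have : `|(M - mv + mu)%:~R : R| < 1 by rewrite -Ed ltr_norml; lra.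
rewrite -intr_norm -[1]/(1%:~R) ltr_int => M1.
by apply/eqP; rewrite -subr_eq0 Ed intr_eq0; lia.
Qed.

(** * Germs of elements of F *)

(** The interval around t shows that f has an affine germ at t, and its right
    half provides points outside a given finite set. *)
Lemma gap (R : realType) (S : seq R) (p t q : R) : p < t -> t < q ->
  exists p' q', [/\ p <= p' < t, t < q' <= q &
    {in S, forall s, p' < s < q' -> s = t}].
Proof.
move=> pt tq; elim: S => [|s S [p1 [q1 [/andP[p1p p1t] /andP[tq1 q1q] H]]]].
  by exists p, q; rewrite !lexx pt tq.
have [st|ts|->] := ltgtP s t.
- exists (Num.max p1 s), q1; rewrite tq1 q1q le_max p1p gt_max p1t st.
  split=> //.
  move=> r; rewrite inE => /predU1P[->|rS]; rewrite gt_max.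
    by rewrite ltxx andbF.
  by move=> /andP[/andP[p1r _] rq]; apply: H; rewrite ?p1r.
- exists p1, (Num.min q1 s); rewrite p1p p1t ge_min q1q lt_min tq1 ts.
  split=> //.
  move=> r; rewrite inE => /predU1P[->|rS]; rewrite lt_min.
    by rewrite ltxx !andbF.
  by move=> /andP[p1r /andP[rq _]]; apply: H; rewrite ?p1r.
- exists p1, q1; rewrite p1p p1t tq1 q1q; split=> // r.
  by rewrite inE => /predU1P[-> //|rS]; exact: H.
Qed.

Lemma gap_right (R : realType) (S : seq R) (t q : R) : t < q ->
  exists2 q', t < q' <= q & {in S, forall s, ~~ (t < s < q')}.
Proof.
move=> tq; have t1 : t - 1 < t by rewrite ltrBlDr ltrDl ltr01.
have [p' [q' [/andP[_ p't] tq' H]]] := gap S t1 tq.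
exists q' => // s /H Hs; apply/negP => /andP[ts sq]; move: Hs.
by rewrite (lt_trans p't ts) sq => /(_ isT) E; rewrite E ltxx in ts.
Qed.

(** The sign of d selects a side: a one-sided affine germ already determines the
    derivative. *)
Lemma is_derive_slope (R : realType) (f : R -> R) (t d a l : R) : d != 0 ->
  (forall r, 0 < r <= 1 -> f (t + r * d) = f t + a * (r * d)) ->
  is_derive t 1 f l -> l = a.
Proof.
move=> d0 fa dfl; apply/eqP/negPn/negP => la.
have cvl : (fun h => h^-1 *: (f (h *: (1 : R) + t) - f t)) @ 0^' --> l.
  rewrite -(@derive_val _ _ _ _ _ _ _ dfl).
  exact: (@ex_derive _ _ _ _ _ _ _ dfl).
have la0 : 0 < `|l - a| by rewrite normr_gt0 subr_eq0.
move/cvgrPdist_lt: cvl => /(_ _ la0) /nbhs_ballP[e /= e0 H].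
have dgt0 : 0 < `|d| by rewrite normr_gt0.
pose r := Num.min 1 (e / 2 / `|d|).
have r0 : 0 < r by rewrite lt_min ltr01 !divr_gt0.
have rd0 : r * d != 0 by rewrite mulf_neq0 // gt_eqF.
have := H (r * d); rewrite /ball /= sub0r normrN normrM (gtr0_norm r0).
have re : r * `|d| < e.
  rewrite -ltr_pdivlMr // gt_min; apply/orP; right.
  by rewrite ltr_pM2r ?invr_gt0 // ltr_pdivrMr // ltr_pMr // ltr1n.
move=> /(_ re rd0); rewrite /GRing.scale /= mulr1 [_ * d + t]addrC.
rewrite fa; last first.
  by rewrite r0 /r ge_min lexx.
by rewrite [f t + _]addrC addrK mulrCA mulVf // mulr1 ltxx.
Qed.

Lemma is_derive_affine (R : realType) (f : R -> R) (p q a c t l : R) :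
  p < q -> p <= t <= q -> (forall r, p <= r <= q -> f r = a * r + c) ->
  is_derive t 1 f l -> l = a.
Proof.
move=> pq /andP[pt tq] fE dfl.
have [tlq|qlt|tEq] := ltgtP t q; last 2 first.
- by move: tq; rewrite leNgt qlt.
- apply: (@is_derive_slope _ f t (p - t) a) dfl.
    by rewrite subr_eq0 lt_eqF // tEq.
  by move=> r r01; rewrite !fE ?pt ?tq //; [lra|nra].
apply: (@is_derive_slope _ f t (q - t) a) dfl.
  by rewrite subr_eq0 gt_eqF.
by move=> r r01; rewrite !fE ?pt ?tq //; [lra|nra].
Qed.

Lemma thompsonF0 (R : realType) (f : R -> R) : thompsonF f -> f 0 = 0.
Proof.
case=> [[f01 _ fsurj]] _ finc _ _.
have [|t t01 ft] := fsurj 0; first by rewrite /= in_itv /= lexx ler01.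
have := f01 0; rewrite /= !in_itv /= lexx ler01 => /(_ isT)/andP[f0 _].
move: t01; rewrite /= in_itv /= => /andP[t0 t1].
have [t_gt0|t_lt0|E] := ltgtP 0 t; last 2 first.
- by move: t0; rewrite leNgt t_lt0.
- by rewrite {1}E.
have := finc 0 t; rewrite !in_itv /= lexx ler01 t0 t1 => /(_ isT isT t_gt0).
by rewrite ft ltNge f0.
Qed.

Lemma itv_partition_piece (R : realType) (s : seq R) (t : R) :
  itv_partition 0 1 s -> 0 <= t <= 1 ->
  exists2 i, (i < size s)%N & nth 1 (0 :: s) i <= t <= nth 1 s i.
Proof.
move=> [ps /eqP lasts] /andP[t0 t1].
have hs : has (fun q => t <= q) s.
  case/lastP: s lasts {ps} => [/=/esym/eqP|s q]; first by rewrite oner_eq0.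
  by rewrite last_rcons has_rcons => ->; rewrite t1.
exists (find (fun q => t <= q) s); first by rewrite -has_find.
rewrite (nth_find 1 hs) andbT.
case E : (find _ s) => [|i] //=.
by rewrite ltW // ltNge (before_find 1) // E.
Qed.

Lemma itv_partition_bounds (R : realType) (s : seq R) i :
  itv_partition 0 1 s -> (i < size s)%N ->
  [/\ 0 <= nth 1 (0 :: s) i, nth 1 (0 :: s) i < nth 1 s i & nth 1 s i <= 1].
Proof.
move=> [ps /eqP lasts] iS.
have ss : sorted <%R (0 :: s) by [].
split; last 1 first.
- rewrite -[X in _ <= X]lasts (last_nth 1) -[nth 1 s i]/(nth 1 (0 :: s) i.+1).
  by rewrite (lt_sorted_leq_nth 1 ss) ?inE //=.
- case: i iS => [|i] iS; first by rewrite lexx.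
  by rewrite -[0]/(nth 1 (0 :: s) 0) (lt_sorted_leq_nth 1 ss) ?inE //= ltnW.
- by move/(pathP 1): ps; apply.
Qed.

(** The partition that witnesses piecewise linearity may contain non-dyadic
    points, but there f is differentiable, so both neighbouring pieces have the
    same slope and constant. *)
Lemma thompsonF_pieces (R : realType) (f : R -> R) : thompsonF f ->
  exists2 s, itv_partition 0 1 s & forall i, (i < size s)%N ->
    exists (k : int) (c : R), dyadic c /\
    forall t, nth 1 (0 :: s) i <= t <= nth 1 s i -> f t = 2 ^ k * t + c.
Proof.
move=> Ff; have f0 := thompsonF0 Ff.
case: Ff => _ _ _ [s [ps fs]] [D [Ddy Dder]]; exists s => //.
have slope i (a c : R) : (i < size s)%N ->
    (forall t, nth 1 (0 :: s) i <= t <= nth 1 s i -> f t = a * t + c) ->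
    exists k : int, a = 2 ^ k.
  move=> iS fE; have [z0 zz z1] := itv_partition_bounds ps iS.
  have [q' /andP[zq qz] HD] := gap_right D zz.
  pose t := (nth 1 (0 :: s) i + q') / 2.
  have [k dk] : exists k : int, is_derive t 1 f (2 ^ k).
    apply: Dder; first by rewrite in_itv /= /t; lra.
    by apply/negP => /HD; rewrite /t; lra.
  exists k; apply/esym; apply: (is_derive_affine zz _ fE dk).
  by rewrite /t; lra.
elim=> [|i IHi] iS; have [a [c fE]] := fs _ iS;
  have [k ak] := slope _ _ _ iS fE.
  exists k, c; rewrite -ak; split=> //.
  have [_ zz _] := itv_partition_bounds ps iS.
  have := fE 0; rewrite f0 mulr0 add0r /= lexx ltW // => /(_ isT) <-.
  exact: (dyadic_int R 0).
have [k' [c' [dc' fE']]] := IHi (ltnW iS).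
have [_ zz' _] := itv_partition_bounds ps (ltnW iS).
have [z0 zz z1] := itv_partition_bounds ps iS.
exists k, c; rewrite -ak; split=> //.
(* p is the breakpoint between the pieces i and i.+1. *)
set p := nth 1 (0 :: s) i.+1 in fE zz z0 *.
have pE : nth 1 s i = p by [].
rewrite pE in zz' fE'.
have Ep : a * p + c = 2 ^ k' * p + c'.
  by rewrite -fE ?lexx ?ltW // fE' // lexx ltW.
have [pD|pD] := boolP (p \in D).
  have -> : c = 2 ^ k' * p + c' + - (a * p) by rewrite -Ep; ring.
  rewrite ak; apply: dyadicD; first by apply: dyadicD => //; apply: dyadicM;
    [exact: dyadic_exp2z|exact: Ddy].
  by apply: dyadicN; apply: dyadicM; [exact: dyadic_exp2z|exact: Ddy].
have [k0 dk0] : exists k : int, is_derive p 1 f (2 ^ k).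
  apply: Dder => //; rewrite in_itv /= (lt_le_trans zz z1) andbT.
  by apply: le_lt_trans zz'; have [] := itv_partition_bounds ps (ltnW iS).
have e1 := is_derive_affine zz (_ : p <= p <= _) fE dk0.
have e2 := is_derive_affine zz' (_ : _ <= p <= p) fE' dk0.
suff -> : c = c' by [].
move: Ep; rewrite -e1 ?lexx ?ltW // -e2 ?lexx ?ltW //.
exact: addrI.
Qed.

Lemma thompsonF_germ (R : realType) (f : R -> R) (t : R) :
  thompsonF f -> 0 <= t <= 1 ->
  exists (k : int) (c : R), dyadic c /\ f t = 2 ^ k * t + c.
Proof.
move=> /thompsonF_pieces[s ps fs] t01.
have [i iS ti] := itv_partition_piece ps t01.
by have [k [c [dc fE]]] := fs i iS; exists k, c; rewrite fE.
Qed.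

(** * Dyadic piecewise linear maps *)

Definition dyadic_affine (R : realType) (f : R -> R) (a b : R) : Prop :=
  exists (k : int) (c : R), dyadic c /\
    forall t : R, a <= t <= b -> f t = 2 ^ k * t + c.

(** The breakpoints enter through the intervals that avoid them, instead of as
    a sorted partition, so that the breakpoints of a composite are just a union
    of two finite sets. *)
Record dyadic_PL (R : realType) (f : R -> R) : Prop := DyadicPL {
  dyadic_PL_range : forall t : R, 0 <= t <= 1 -> 0 <= f t <= 1;
  dyadic_PL_surj : forall t : R, 0 <= t <= 1 ->
    exists2 r : R, 0 <= r <= 1 & f r = t;
  dyadic_PL_increasing :
    forall t r : R, 0 <= t <= 1 -> 0 <= r <= 1 -> t < r -> f t < f r;
  dyadic_PL_affine : exists2 S : seq R, {in S, forall s, dyadic s} &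
    forall a b : R, 0 <= a -> a < b -> b <= 1 ->
      {in S, forall s : R, ~~ (a < s < b)} -> dyadic_affine f a b
}.

Lemma dyadic_PL_mono (R : realType) (f : R -> R) t r : dyadic_PL f ->
  0 <= t <= 1 -> 0 <= r <= 1 -> (f t < f r) = (t < r).
Proof.
move=> [_ _ finc _] t01 r01; have [tr|rt|->] := ltgtP t r; last by rewrite ltxx.
  exact: finc.
by apply/negbTE; rewrite -leNgt ltW // finc.
Qed.

(** The points of S in ]0, 1], together with 1, are sorted. *)
Lemma adapted_partition (R : realType) (S : seq R) :
  exists2 s : seq R, itv_partition 0 1 s & forall i, (i < size s)%N ->
    {in S, forall r, ~~ (nth 1 (0 :: s) i < r < nth 1 s i)}.
Proof.
pose s := sort <=%R (undup [seq r <- 1 :: S | 0 < r <= 1]).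
have mems r : (r \in s) = ((r == 1) || (r \in S)) && (0 < r <= 1).
  by rewrite mem_sort mem_undup mem_filter inE andbC.
have ss : sorted <%R s by rewrite sort_lt_sorted undup_uniq.
have ps : path <%R 0 s.
  rewrite lt_path_sortedE ss andbT; apply/allP => r.
  by rewrite mems => /and3P[].
have s1 : 1 \in s by rewrite mems eqxx ltr01 lexx.
have ss0 : sorted <%R (0 :: s) by [].
have part : itv_partition 0 1 s.
  split=> //; apply/eqP/le_anti/andP; split.
    have := mem_last 0 s; rewrite inE mems => /orP[/eqP->|/and3P[] //].
    exact: ler01.
  have m1 : 1 \in 0 :: s by rewrite inE s1 orbT.
  have i1 : (index 1%R (0%R :: s) < (size s).+1)%N.
    by rewrite -[(size s).+1]/(size (0 :: s)%R) index_mem.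
  by rewrite (last_nth 1) -{1}(nth_index 1 m1) (lt_sorted_leq_nth 1 ss0) ?inE.
exists s => // i iS r rS; apply/negP => /andP[ir ri].
have [z0 _ z1] := itv_partition_bounds part iS.
have rs : r \in s.
  by rewrite mems rS orbT (le_lt_trans z0 ir) (le_trans (ltW ri) z1).
have ri' : (index r s < i)%N.
  move: ri; rewrite -{1}(nth_index 1 rs) (lt_sorted_ltn_nth 1 ss) ?inE //.
  by rewrite index_mem.
move: ir; rewrite -(nth_index 1 rs).
rewrite -[nth 1 s (index r s)]/(nth 1 (0 :: s) (index r s).+1).
rewrite (lt_sorted_ltn_nth 1 ss0) ?inE; first by rewrite ltnS leqNgt ri'.
  exact: (ltnW iS).
by rewrite ltnS index_mem.
Qed.

Lemma is_derive_affine_near (R : realType) (f : R -> R) (p q t a c : R) :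
  p < t < q -> (forall r, p <= r <= q -> f r = a * r + c) -> is_derive t 1 f a.
Proof.
move=> /andP[pt tq] fE.
apply: (@near_eq_is_derive _ _ _ (fun r => a * r + c)).
  near=> r; rewrite fE //; apply/andP; split.
    by apply: ltW; near: r; exact: lt_nbhsr.
  by apply: ltW; near: r; exact: lt_nbhsl.
have -> : (fun r => a * r + c) = (a \*: (@id R)) + cst c by [].
apply: is_derive_eq.
by rewrite addr0 /GRing.scale /= mulr1.
Unshelve. all: by end_near. Qed.

(** Continuity follows from monotonicity and surjectivity. *)
Lemma dyadic_PL_thompsonF (R : realType) (f : R -> R) :
  dyadic_PL f -> thompsonF f.
Proof.
move=> Pf; have [fr fs finc [S Sdy Saff]] := Pf.
have i01 (t : R) : (t \in `[0, 1]) = (0 <= t <= 1) by rewrite in_itv.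
have fs' : set_surj `[0, 1] `[0, 1] f.
  by move=> t /=; rewrite i01 => /fs[r r01 <-]; exists r; rewrite //= i01.
split.
- split=> //.
  move=> t r; rewrite !inE /= !i01 => t01 r01 E.
  have := dyadic_PL_mono Pf t01 r01; have := dyadic_PL_mono Pf r01 t01.
  by rewrite E ltxx; case: ltgtP.
- have f0 : f 0 = 0.
    have [|r r01 r0] := fs 0; first by rewrite lexx ler01.
    have /andP[f0 _] : 0 <= f 0 <= 1 by apply: fr; rewrite lexx ler01.
    apply/eqP; rewrite eq_le f0 andbT -{2}r0 leNgt.
    rewrite dyadic_PL_mono ?lexx ?ler01 //.
    by rewrite -leNgt; case/andP: r01.
  have f1 : f 1 = 1.
    have [|r r01 r1] := fs 1; first by rewrite lexx ler01.
    have /andP[_ f1] : 0 <= f 1 <= 1 by apply: fr; rewrite lexx ler01.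
    apply/eqP; rewrite eq_le f1 /= -{1}r1 leNgt dyadic_PL_mono ?lexx ?ler01 //.
    by rewrite -leNgt; case/andP: r01.
  apply: segment_inc_surj_continuous; last by rewrite f0 f1.
  by move=> t r; rewrite !i01 => t01 r01; rewrite !leNgt dyadic_PL_mono.
- by move=> t r; rewrite !i01 => t01 r01 tr; exact: finc.
- have [s ps Hs] := adapted_partition S; exists s; split=> // i iS.
  have [z0 zz z1] := itv_partition_bounds ps iS.
  have [k [c [_ fE]]] := Saff _ _ z0 zz z1 (Hs i iS).
  by exists (2 ^ k), c.
- exists S; split=> // t; rewrite in_itv /= => /andP[t0 t1] tS.
  have [p [q [/andP[p0 pt] /andP[tq q1] HS]]] := gap S t0 t1.
  have [s sS|k [c [_ fE]]] := Saff p q p0 (lt_trans pt tq) q1.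
    apply/negP => sp; have E := HS s sS sp; by rewrite -E sS in tS.
  by exists k; apply: (is_derive_affine_near _ fE); rewrite pt tq.
Qed.

(** Near t the map is affine with dyadic coefficients and slope a power of 2,
    hence so is its inverse. *)
Lemma dyadic_PL_dyadic (R : realType) (f : R -> R) (t : R) :
  dyadic_PL f -> 0 <= t <= 1 -> dyadic (f t) <-> dyadic t.
Proof.
move=> /dyadic_PL_thompsonF Ff /(thompsonF_germ Ff)[k [c [dc ->]]].
split=> d; last first.
  by apply: dyadicD => //; apply: dyadicM => //; exact: dyadic_exp2z.
have -> : t = 2 ^ (- k) * ((2 ^ k * t + c) + - c).
  by rewrite addrK mulrA -expfzDr // addNr expr0z mul1r.
by apply: dyadicM; [exact: dyadic_exp2z|apply: dyadicD => //; exact: dyadicN].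
Qed.

(** The breakpoints of the composite are those of f and the preimages of those
    of g. *)
Lemma dyadic_PL_comp (R : realType) (f g : R -> R) :
  dyadic_PL f -> dyadic_PL g -> dyadic_PL (g \o f).
Proof.
move=> Pf Pg; have [fr fs finc [S Sdy Saff]] := Pf.
have [gr gs ginc [T Tdy Taff]] := Pg.
split.
- by move=> t t01; apply/gr/fr.
- by move=> t /gs[r r01 <-]; have [q q01 <-] := fs r r01; exists q.
- by move=> t r t01 r01 tr; apply: ginc; [exact: fr|exact: fr|exact: finc].
have /choice[h hP] : forall s, exists r, 0 <= s <= 1 -> 0 <= r <= 1 /\ f r = s.
  move=> s; case: (boolP (0 <= s <= 1)) => [/fs[r r01 rs]|_]; last by exists 0.
  by exists r.
exists (S ++ [seq h s | s <- T & 0 <= s <= 1]).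
  move=> r; rewrite mem_cat => /orP[/Sdy//|/mapP[s]].
  rewrite mem_filter => /andP[s01 sT ->]; have [h01 fh] := hP s s01.
  by apply/(dyadic_PL_dyadic Pf h01); rewrite fh; exact: Tdy.
move=> a b a0 ab b1 H.
have a01 : 0 <= a <= 1 by rewrite a0 (le_trans (ltW ab) b1).
have b01 : 0 <= b <= 1 by rewrite b1 (le_trans a0 (ltW ab)).
have /andP[fa0 _] := fr a a01; have /andP[_ fb1] := fr b b01.
have [|k [c [dc fE]]] := Saff a b a0 ab b1.
  by move=> s sS; apply: H; rewrite mem_cat sS.
have [|k' [c' [dc' gE]]] := Taff (f a) (f b) fa0 (finc a b a01 b01 ab) fb1.
  move=> s sT; apply/negP => /andP[as_ sb].
  have s01 : 0 <= s <= 1.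
    by rewrite (le_trans fa0 (ltW as_)) (le_trans (ltW sb) fb1).
  have [h01 fh] := hP s s01.
  have /negP[] : ~~ (a < h s < b).
    apply: H; rewrite mem_cat; apply/orP; right; apply/mapP; exists s => //.
    by rewrite mem_filter s01.
  rewrite -(dyadic_PL_mono Pf a01 h01) -(dyadic_PL_mono Pf h01 b01).
  by rewrite fh as_ sb.
exists (k' + k), (2 ^ k' * c + c'); split.
  by apply: dyadicD => //; apply: dyadicM => //; exact: dyadic_exp2z.
move=> t /andP[at_ tb].
have t01 : 0 <= t <= 1 by rewrite (le_trans a0 at_) (le_trans tb b1).
rewrite /= gE; last by rewrite !leNgt !(dyadic_PL_mono Pf) // -!leNgt at_ tb.
by rewrite fE ?at_ ?tb // expfzDr // mulrDr mulrA addrA.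
Qed.

(** The breakpoints of the inverse are the images of those of f. *)
Lemma dyadic_PL_inv (R : realType) (f : R -> R) : dyadic_PL f ->
  exists2 g : R -> R, dyadic_PL g & forall t, 0 <= t <= 1 -> g (f t) = t.
Proof.
move=> Pf; have [fr fs _ [S Sdy Saff]] := Pf.
have /choice[g gP] : forall t, exists r, 0 <= t <= 1 -> 0 <= r <= 1 /\ f r = t.
  move=> t; case: (boolP (0 <= t <= 1)) => [/fs[r r01 rt]|_]; last by exists 0.
  by exists r.
have gf t : 0 <= t <= 1 -> g (f t) = t.
  move=> t01; have [g01 fg] := gP _ (fr t t01).
  have := dyadic_PL_mono Pf g01 t01; have := dyadic_PL_mono Pf t01 g01.
  by rewrite fg ltxx; case: ltgtP.
have g_incr t r : 0 <= t <= 1 -> 0 <= r <= 1 -> t < r -> g t < g r.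
  move=> t01 r01; have [gt01 fgt] := gP t t01; have [gr01 fgr] := gP r r01.
  by rewrite -(dyadic_PL_mono Pf gt01 gr01) fgt fgr.
exists g => //; split=> //; first by move=> t /gP[].
  by move=> t t01; exists (f t); [exact: fr|exact: gf].
exists [seq f s | s <- S & 0 <= s <= 1].
  move=> _ /mapP[s + ->]; rewrite mem_filter => /andP[s01 sS].
  by apply/(dyadic_PL_dyadic Pf s01); exact: Sdy.
move=> a b a0 ab b1 H.
have a01 : 0 <= a <= 1 by rewrite a0 (le_trans (ltW ab) b1).
have b01 : 0 <= b <= 1 by rewrite b1 (le_trans a0 (ltW ab)).
have [/andP[ga0 _] fga] := gP a a01; have [/andP[_ gb1] fgb] := gP b b01.
have [s sS|k [c [dc fE]]] := Saff _ _ ga0 (g_incr a b a01 b01 ab) gb1.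
  apply/negP => /andP[as_ sb].
  have s01 : 0 <= s <= 1.
    by rewrite (le_trans ga0 (ltW as_)) (le_trans (ltW sb) gb1).
  have /negP[] : ~~ (a < f s < b).
    by apply: H; apply/mapP; exists s => //; rewrite mem_filter s01.
  rewrite -{1}fga -fgb !(dyadic_PL_mono Pf) ?as_ //; [exact: (gP b b01).1|].
  exact: (gP a a01).1.
exists (- k), (2 ^ (- k) * - c); split.
  by apply: dyadicM; [exact: dyadic_exp2z|exact: dyadicN].
move=> t /andP[at_ tb].
have t01 : 0 <= t <= 1 by rewrite (le_trans a0 at_) (le_trans tb b1).
have [gt01 fgt] := gP t t01.
have tE : t = 2 ^ k * g t + c.
  rewrite -fE ?fgt //.
  by rewrite !leNgt -(dyadic_PL_mono Pf gt01 (gP a a01).1)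
    -(dyadic_PL_mono Pf (gP b b01).1 gt01) fgt fga fgb -!leNgt at_.
by rewrite -mulrDr {2}tE addrK mulrA -expfzDr // addNr expr0z mul1r.
Qed.

Lemma dyadic_PL_id (R : realType) : dyadic_PL (@id R).
Proof.
split=> //; first by move=> t t01; exists t.
exists [::] => // a b _ _ _ _; exists 0, 0.
split; first exact: (dyadic_int R 0).
by move=> t _; rewrite expr0z mul1r addr0.
Qed.

(** * The generators belong to F *)

(** Explicit inverses, from which the surjectivity of the generators is read
    off. *)
Definition genRinv (R : realType) (s : gen) (t : R) : R :=
  match s with
  | X0 => if t <= 1 / 4 then 2 * t
          else if t <= 1 / 2 then t + 1 / 4
          else (t + 1) / 2
  | X1 => if t <= 1 / 2 then t
          else if t <= 5 / 8 then 2 * t - 1 / 2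
          else if t <= 3 / 4 then t + 1 / 8
          else (t + 1) / 2
  end.

Ltac split_ifs :=
  repeat (case: ifP => [/idP|/negbT]; rewrite -?ltNge => ?).

Lemma genRinvK (R : realType) s : cancel (@genRinv R s) (genR s).
Proof.
by case: s => t; rewrite /genRinv; split_ifs; rewrite /genR; split_ifs; lra.
Qed.

Lemma genR_incr (R : realType) s (t r : R) : t < r -> genR s t < genR s r.
Proof. case: s => tr; rewrite /genR; split_ifs; lra. Qed.

Lemma genR01 (R : realType) s (t : R) : 0 <= t <= 1 -> 0 <= genR s t <= 1.
Proof. case: s => t01; rewrite /genR; split_ifs; lra. Qed.

Lemma genRinv01 (R : realType) s (t : R) : 0 <= t <= 1 -> 0 <= genRinv s t <= 1.
Proof. case: s => t01; rewrite /genRinv; split_ifs; lra. Qed.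

(** For the case analysis on an interval free of breakpoints, which treats one
    breakpoint at a time. *)
Lemma avoid_cons (R : realType) (S : seq R) (p a b : R) : a < b ->
  {in p :: S, forall s, ~~ (a < s < b)} ->
  (b <= p \/ p <= a) /\ {in S, forall s, ~~ (a < s < b)}.
Proof.
move=> ab H; split; last by move=> s sS; apply: H; rewrite inE sS orbT.
have := H p (mem_head _ _); rewrite negb_and -!leNgt.
by case/orP; [right|left].
Qed.

Lemma dyadic_affine_frac (R : realType) (f : R -> R) (a b c : R) (k m : int) n :
  c = m%:~R / 2 ^+ n -> (forall t, a <= t <= b -> f t = 2 ^ k * t + c) ->
  dyadic_affine f a b.
Proof.
by move=> -> fE; exists k, (m%:~R / 2 ^+ n); split=> //; exists m, n.
Qed.

Lemma genR_dyadic_PL (R : realType) s : dyadic_PL (@genR R s).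
Proof.
split; [by move=> t; exact: genR01| |by move=> t r _ _; exact: genR_incr|].
  by move=> t /(genRinv01 s) t01; exists (genRinv s t) => //; exact: genRinvK.
case: s.
- exists [:: 1 / 2; 3 / 4].
    move=> r; rewrite !inE => /orP[] /eqP ->;
      by [exists 1, 1%N; lra|exists 3, 2%N; lra].
  move=> a b a0 ab b1 /(avoid_cons ab)[p1] /(avoid_cons ab)[p2] _.
  have [b2|a2] := p1.
    apply: (@dyadic_affine_frac _ _ _ _ 0 (-1) 0 0); first lra.
    by move=> t tab; rewrite /genR; split_ifs; rewrite ?exprN1; lra.
  have [b3|a3] := p2.
    apply: (@dyadic_affine_frac _ _ _ _ (- (1 / 4)) 0 (-1) 2); first lra.
    by move=> t tab; rewrite /genR expr0z; split_ifs; lra.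
  apply: (@dyadic_affine_frac _ _ _ _ (- 1) 1 (-1) 0); first lra.
  by move=> t tab; rewrite /genR expr1z; split_ifs; lra.
- exists [:: 1 / 2; 3 / 4; 7 / 8].
    move=> r; rewrite !inE => /or3P[] /eqP ->;
      [exists 1, 1%N|exists 3, 2%N|exists 7, 3%N]; lra.
  move=> a b a0 ab b1.
  move=> /(avoid_cons ab)[p1] /(avoid_cons ab)[p2] /(avoid_cons ab)[p3] _.
  have [b2|a2] := p1.
    apply: (@dyadic_affine_frac _ _ _ _ 0 0 0 0); first lra.
    by move=> t tab; rewrite /genR expr0z; split_ifs; lra.
  have [b3|a3] := p2.
    apply: (@dyadic_affine_frac _ _ _ _ (1 / 4) (-1) 1 2); first lra.
    by move=> t tab; rewrite /genR; split_ifs; rewrite ?exprN1; lra.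
  have [b4|a4] := p3.
    apply: (@dyadic_affine_frac _ _ _ _ (- (1 / 8)) 0 (-1) 3); first lra.
    by move=> t tab; rewrite /genR expr0z; split_ifs; lra.
  apply: (@dyadic_affine_frac _ _ _ _ (- 1) 1 (-1) 0); first lra.
  by move=> t tab; rewrite /genR expr1z; split_ifs; lra.
Qed.

(** * The labelling as an isomorphism onto the Schreier graph *)

Definition PL_orbit (R : realType) (x y : R) : Prop :=
  exists2 f : R -> R, dyadic_PL f & f x = y.

Lemma PL_orbit_genR (R : realType) s (x y : R) : 0 <= y <= 1 ->
  PL_orbit x y <-> PL_orbit x (genR s y).
Proof.
move=> y01; split=> -[f Pf fx].
  exists (genR s \o f); last by rewrite /= fx.
  by apply: dyadic_PL_comp => //; exact: genR_dyadic_PL.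
have [g Pg gK] := dyadic_PL_inv (@genR_dyadic_PL R s).
by exists (g \o f); [exact: dyadic_PL_comp|rewrite /= fx gK].
Qed.

Lemma plabel_orbit (R : realType) w y z :
  PL_orbit (bval R (plabel w y)) (bval R (plabel w z)).
Proof.
pose Q v := PL_orbit (bval R (plabel w y)) (bval R (plabel w v)).
apply: (@P_connected w Q _ y); last by exists id => //; exact: dyadic_PL_id.
move=> s v; rewrite /Q plabel_next bval_std_act.
by apply: PL_orbit_genR; exact: bval01.
Qed.

Lemma irrational_plabel (R : realType) w y :
  irrational (bval R w) -> irrational (bval R (plabel w y)).
Proof.
have Htail v : irrational (bval R w) -> irrational (bval R (tail_label w v)).
  by move=> irw; apply/(irrational_wdrop _ _ (meet_at v).1);
    rewrite tail_label_meet; apply/irrational_wdrop.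
by case: y => [v|i v|i v] irw; apply/irrational_block/Htail.
Qed.

(** A point of the orbit shares a tail with x; removing its first block leaves
    a word that shares a tail with w, hence a tail label. *)
Lemma plabel_onto (R : realType) b n w (y : R) :
  irrational (bval R w) -> orbitF (bval R (block b n w)) y ->
  exists v, bval R (plabel w v) = y.
Proof.
move=> irw [f Ff fx]; set u := block b n w in fx.
have iru : irrational (bval R u) by apply/irrational_block.
have y01 : 0 <= y <= 1.
  have [[f01 _ _] _ _ _ _] := Ff.
  have := f01 (bval R u); rewrite fx /= !in_itv /=; apply; exact: bval01.
have [k [c [dc fE]]] := thompsonF_germ Ff (bval01 R u).
have rdy (d : R) : dyadic d -> rational d.
  move=> [m [N ->]]; apply: rationalM; first exact: rational_int.
  by apply: rationalV; exact: rational_pow2.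
have [v vy] := bval_surj y01.
have irv : irrational (bval R v).
  rewrite vy -fx fE => r; apply: iru; apply: rational_affine r.
  - by rewrite expfz_neq0.
  - by apply: rdy; exact: dyadic_exp2z.
  - exact: rdy.
have [|i [j vu]] := @dyadic_affine_tail _ u v k c iru irv dc.
  by rewrite vy -fx fE.
have [b' [n' [v' [n'0 vE]]]] := block_exists (irrational_constant irv).
have [g gE] : exists g, tail_label w g = v'.
  apply: (@tail_label_surj _ _ (i + n.+1) (j + n'.+1)).
  transitivity (wdrop (n.+1 + n'.+1) (wdrop i v)).
    rewrite -[in LHS](wdrop_block b' n' v') -vE !wdrop_wdrop.
    by apply: (congr1 (wdrop^~ v)); lia.
  rewrite vu -[in RHS](wdrop_block b n w) !wdrop_wdrop.
  by apply: (congr1 (wdrop^~ u)); lia.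
have [z zE] := plabel_surj w b' g n'0.
by exists z; rewrite zE gE -vE.
Qed.

Theorem theorem3p3 (R : realType) (x : R) (u : word)
    (x01 : 0 <= x <= 1) (x_irr : irrational x) (xu : binary_expansion x u) :
  (exists! d : bool * nat * word,
     (1 <= d.1.2)%N /\ u = block d.1.1 d.1.2 d.2) /\
  forall (b : bool) (n : nat) (w : word), (1 <= n)%N -> u = block b n w ->
  exists phi : P w -> schreier x,
    pointed_iso (P_base b n : P w) (schreier_base x) phi /\
    exists label : P w -> word,
      (forall y : P w, binary_expansion (val (phi y)) (label y)) /\
      (* (1) *)
      (label (P_base b n) = u /\
       label (Grey (g_ 0)) = prepend [:: true; false] w) /\
      (* (2) *)
      ((forall y : P w,
          (exists w' : word, label y = prepend [:: true; false] w') <->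
          exists v : grey, y = Grey v) /\
       (forall v : grey, exists psi : hanging w v -> hanging w (g_ 0),
          canonical_iso psi)) /\
      (* (3) *)
      (forall k : nat, (1 <= k)%N ->
         (w k.-1 = false -> right_child w (g_ k) = g_ k.-1) /\
         (w k.-1 = true -> left_child w (g_ k) = g_ k.-1)) /\
      (* (4) *)
      (forall (s : gen) (y z : P w), edge s y z ->
         label z = std_act s (label y)).
Proof.
have ux : bval R u = x by apply/binary_expansionP.
have iru : irrational (bval R u) by rewrite ux.
split.
  have [b [n [w [n0 uE]]]] := block_exists (irrational_constant iru).
  exists (b, n, w); split=> // -[[b' n'] w'] /= [n'0].
  by rewrite uE => /(block_inj n0 n'0)[-> -> ->].
move=> b n w n0 uE.
have irw : irrational (bval R w) by move: iru; rewrite uE => /irrational_block.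
have aw := irrational_aperiodic irw.
have base_label : plabel w (P_base b n) = u by rewrite plabel_base.
have orbit_label y : bval R (plabel w y) \in orbitF x.
  rewrite inE; have [f Pf fx] := plabel_orbit R w (P_base b n) y.
  by exists f; [exact: dyadic_PL_thompsonF|rewrite -ux -base_label].
pose phi (y : P w) : schreier x :=
  exist (fun r => r \in orbitF x) (bval R (plabel w y)) (orbit_label y).
have phi_inj : injective phi.
  move=> y z /(congr1 val)/= /(bval_inj (irrational_plabel irw)).
  exact: plabel_inj.
have phi_onto z : exists y, phi y = z.
  have zx : orbitF x (val z) by have := valP z; rewrite inE.
  have [|y yz] := @plabel_onto R b n w (val z) irw; first by rewrite -uE ux.
  by exists y; apply: val_inj.
have phi_next s y : genR s (val (phi y)) = val (phi (Pnext w s y)).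
  by rewrite /= plabel_next bval_std_act.
exists phi; split; last first.
  exists (plabel w); split; [|split; [|split; [|split]]].
  - by move=> y; apply/binary_expansionP.
  - by split=> //=; rewrite prepend_nil.
  - by split=> [y|v]; [exact: plabel_grey|exact: hanging_iso].
  - by case=> // k _; split=> /= ->.
  - by move=> s y z /PedgeP ->; exact: plabel_next.
split; last by apply: val_inj; rewrite /= base_label.
split.
  have /choice[psi psiK] := phi_onto.
  by exists psi => // y; apply: phi_inj; rewrite psiK.
move=> s y z; apply: (iff_trans (PedgeP w s y z)).
split=> [->|]; first exact: phi_next.
rewrite /edge /= -/(val (phi y)) phi_next => E.
by apply: phi_inj; apply: val_inj.
Qed.
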